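(* Let $a,b$ be positive integers with $\gcd(a,b)=1$. Then: (1) the proportion of points of $\mathbb{N}_a\times\mathbb{N}$ that are $(b/a)$-visible equals $\frac{1}{\zeta(b+1)}$; (2) the proportion of points of $\mathbb{N}_a\times\mathbb{N}$ that are $(-b/a)$-visible equals $\frac{1}{\zeta(b)}$.
   Context: $\mathbb{N}=\{1,2,3,\ldots\}$ and $\mathbb{N}_a=\{\ell^a:\ell\in\mathbb{N}\}$. $\zeta$ is the Riemann zeta function; for $b=1$, $\frac{1}{\zeta(1)}$ is understood as $0$ (the value of $\prod_p(1-1/p)$). For a rational $c>0$: a point $(r,s)\in\mathbb{N}\times\mathbb{N}$ is $c$-visible if it lies on the graph of $f(x)=nx^{c}$ for some $n\in\mathbb{Q}$, and no other point of $\mathbb{N}\times\mathbb{N}$ lies on the graph of $f$ between $(0,0)$ and $(r,s)$ (i.e. no $(r',s')\in\mathbb{N}\times\mathbb{N}$ with $s'=f(r')$ and $0<r'<r$). For a rational $c>0$: a point $(r,s)\in\mathbb{N}\times\mathbb{N}$ is $(-c)$-visible (visibility from the point at infinity $(\infty,0)$ on the positive $x$-axis) if it lies on the graph of $f(x)=nx^{-c}$ for some $n\in\mathbb{Q}$, and no other point of $\mathbb{N}\times\mathbb{N}$ lies on the graph of $f$ between $(r,s)$ and $(\infty,0)$ (i.e. no $(r',s')\in\mathbb{N}\times\mathbb{N}$ with $s'=f(r')$ and $r'>r$). Proportion: with $[N]=\{1,\ldots,N\}$ and $[N]_a=\{1^a,2^a,\ldots,\lfloor N^{1/a}\rfloor^a\}$,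 the proportion of points of $\mathbb{N}_a\times\mathbb{N}$ having a property is $\lim_{N\to\infty}$ of the fraction of pairs $(r,s)\in[N]_a\times[N]$ having that property. *)

(* Defs.v *)
From mathcomp Require Import all_boot all_order all_algebra.
From mathcomp Require Import all_classical all_reals all_analysis.
Import Order.TTheory GRing.Theory Num.Theory.
Import numFieldNormedType.Exports.

Set Implicit Arguments.
Unset Strict Implicit.
Unset Printing Implicit Defensive.

Local Open Scope ring_scope.
Local Open Scope classical_set_scope.

(* The set of positive integers is encoded as nat with explicit positivity. *)
Definition lattice_point (p : nat * nat) : Prop := (0 < p.1)%N /\ (0 < p.2)%N.

(* The point (r, s) lies on the graph of x |-> n x^c, an equality of reals. *)
Definition on_graph (R : realType) (n c : rat) (p : nat * nat) : Prop :=
  (p.2)%:R = ratr n * (p.1)%:R `^ ratr c :> R.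

(* c-visibility, from the origin; meant for c > 0. *)
Definition visible (R : realType) (c : rat) (p : nat * nat) : Prop :=
  lattice_point p /\
  exists n : rat, on_graph R n c p /\
    ~ (exists q : nat * nat,
         [/\ lattice_point q, on_graph R n c q & (q.1 < p.1)%N]).

(* (-c)-visibility, from the point at infinity (oo, 0); meant for c > 0,
   the curve being x |-> n x^(-c). *)
Definition visible_infty (R : realType) (c : rat) (p : nat * nat) : Prop :=
  lattice_point p /\
  exists n : rat, on_graph R n (- c) p /\
    ~ (exists q : nat * nat,
         [/\ lattice_point q, on_graph R n (- c) q & (p.1 < q.1)%N]).

(* [N]_a = {1^a, 2^a, ..., floor(N^(1/a))^a}, without repetition for a > 0:
   l <= floor(N^(1/a)) iff l^a <= N, and then l <= l^a <= N. *)
Definition powers_upto (a N : nat) : seq nat :=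
  [seq (l ^ a)%N | l <- iota 1 N & (l ^ a <= N)%N].

(* [N]_a x [N] *)
Definition box (a N : nat) : seq (nat * nat) :=
  [seq (r, s) | r <- powers_upto a N, s <- iota 1 N].

Definition fraction (R : realType) (a : nat) (P : nat * nat -> Prop)
    (N : nat) : R :=
  (count (fun p => `[< P p >]) (box a N))%:R / (size (box a N))%:R.

(* Both the existence of the limit and its value are asserted. *)
Definition has_proportion (R : realType) (a : nat) (P : nat * nat -> Prop)
    (d : R) : Prop :=
  fraction R a P N @[N --> \oo] --> d.

(* The Riemann zeta function at a real argument x > 1. *)
Definition zeta (R : realType) (x : R) : R := limn (series (riemannR x)).

(* 1 / zeta(x) for x >= 1, with 1 / zeta(1) = 0. *)
Definition inv_zeta (R : realType) (x : R) : R :=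
  if x == 1 then 0 else (zeta x)^-1.

(* Main.v *)
Require Import Defs.
From mathcomp Require Import all_boot all_order all_algebra.
From mathcomp Require Import all_classical all_reals all_analysis.
From mathcomp Require Import ring lra.
Import Order.TTheory GRing.Theory Num.Theory.
Import numFieldNormedType.Exports.

(** Since gcd(a, b) = 1, a lattice point on a curve through (l^a, s) again has
  its abscissa of the form k^a, so (l^a, s) is (b/a)-visible iff no d > 1
  satisfies d | l and d^b | s, and (-b/a)-visible iff no d > 1 satisfies
  d^b | s.  These are the cases i = 1 and i = 0 of: no d > 1 has d^i | l and
  d^b | s.  If i + b = 1 only s = 1 survives and the density is 0.  Otherwise
  let V(x, y) count such pairs in [x] x [y], and let k = i + b >= 2.
  Sorting all pairs by their largest d gives
    x y = sum_d V(x / d^i, y / d^b)   (floors understood).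
  Isolating d = 1, an eventual bound |V - x y / zeta(k)| <= e x y improves to
  the same bound with e (zeta(k) - 1 + o(1)) in place of e.  As zeta(k) - 1 <=
  3/4, iterating this contraction gives the density 1 / zeta(k), without
  Moebius inversion or an Euler product. *)

Set Implicit Arguments.
Unset Strict Implicit.
Unset Printing Implicit Defensive.

Local Open Scope ring_scope.

(** Ordinary coprimality for [i = j = 1]. For [i = 0] the condition on [l] is void, since
    [d ^ 0 = 1], and [s] has to be [j]-th power free. *)
Definition power_coprime (i j l s : nat) : Prop :=
  forall d, (d ^ i %| l)%N -> (d ^ j %| s)%N -> d = 1%N.

Definition count_power_coprime (i j x y : nat) : nat :=
  (\sum_(1 <= l < x.+1) \sum_(1 <= s < y.+1) `[< power_coprime i j l s >])%N.

(** * Sorting pairs by their largest common power divisor *)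

Section Arithmetic.
Local Open Scope nat_scope.

Lemma sum_dvdn_div D x (F : nat -> nat) : 0 < D ->
  \sum_(1 <= l < x.+1 | D %| l) F (l %/ D) = \sum_(1 <= m < (x %/ D).+1) F m.
Proof.
move=> D0; elim: x => [|x IH]; first by rewrite div0n !big_geq.
rewrite big_mkcond big_nat_recr //= -big_mkcond IH divnS //.
case: (D %| _); last by rewrite addn0.
by rewrite add1n [in RHS]big_nat_recr.
Qed.

Lemma dvdn_mul_exp i l d u v : coprime u v ->
  (d * u) ^ i %| l -> (d * v) ^ i %| l -> (d * u * v) ^ i %| l.
Proof.
move=> cop; rewrite !expnMn.
have [d0|d0] := posnP (d ^ i); first by rewrite d0 !mul0n.
move=> du dv.
have /dvdnP[k lk] : d ^ i %| l by apply: dvdn_trans du; rewrite dvdn_mulr.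
move: du dv; rewrite lk (mulnC k) -mulnA !dvdn_pmul2l // => uk vk.
by rewrite Gauss_dvd ?uk // coprimeXl // coprimeXr.
Qed.

(** With d = g u, e = g v and u, v coprime, the lcm g u v is again admissible, so v^i and v^j divide
    the two quotients, forcing v = 1. *)
Lemma power_coprime_quotient_max i j l s d e : 0 < l -> 0 < s ->
  d ^ i %| l -> d ^ j %| s -> power_coprime i j (l %/ d ^ i) (s %/ d ^ j) ->
  e ^ i %| l -> e ^ j %| s -> 0 < d -> 0 < e -> e %| d.
Proof.
move=> l0 s0 dl ds pc el es d0 e0.
pose g := gcdn d e; pose u := d %/ g; pose v := e %/ g.
have g0 : 0 < g by rewrite gcdn_gt0 d0.
have du : d = g * u by rewrite mulnC divnK // dvdn_gcdl.
have ev : e = g * v by rewrite mulnC divnK // dvdn_gcdr.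
have cuv : coprime u v.
  by rewrite /coprime -(eqn_pmul2l g0) muln1 muln_gcdr -du -ev.
clearbody u v g.
suff v1 : v = 1 by rewrite ev v1 muln1 du dvdn_mulr.
have dvd_quo k m : d ^ k %| m -> e ^ k %| m -> v ^ k %| m %/ d ^ k.
  move=> dm em; rewrite dvdn_divRL // mulnC -expnMn du.
  by apply: dvdn_mul_exp; rewrite // -?du -?ev.
exact: pc (dvd_quo _ _ dl el) (dvd_quo _ _ ds es).
Qed.

(** Only the largest admissible d contributes; it lies in the range because d <= d^j <= s <= y. *)
Lemma sum_power_coprime_quotient i j l s y : 0 < j -> 0 < l -> 0 < s <= y ->
  \sum_(1 <= d < y.+1 | (d ^ i %| l) && (d ^ j %| s))
     `[< power_coprime i j (l %/ d ^ i) (s %/ d ^ j) >] = 1.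
Proof.
move=> j0 l0 /andP[s0 sy].
have ex1 : exists d, (d ^ i %| l) && (d ^ j %| s) by exists 1; rewrite !exp1n !dvd1n.
have bnd d : (d ^ i %| l) && (d ^ j %| s) -> d <= s.
  move=> /andP[_ ds]; apply: (dvdn_leq s0); apply: dvdn_trans ds.
  by apply: dvdn_exp.
have pos d : d ^ j %| s -> 0 < d.
  by case: d => // ; rewrite exp0n // dvd0n => /eqP s00; rewrite s00 in s0.
have [d /andP[dl ds] dmax] := ex_maxnP ex1 bnd.
have d0 := pos _ ds.
(* If e^i and e^j divided the quotients, d e would be admissible; maximality of d gives e = 1. *)
have pcd : power_coprime i j (l %/ d ^ i) (s %/ d ^ j).
  move=> e; rewrite -(@dvdn_pmul2l (d ^ i)) ?expn_gt0 ?d0 // [X in _ %| X]mulnC divnK //.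
  rewrite -expnMn => el.
  rewrite -(@dvdn_pmul2l (d ^ j)) ?expn_gt0 ?d0 // [X in _ %| X]mulnC divnK //.
  rewrite -expnMn => es.
  have := dmax (d * e); rewrite el es => /(_ isT).
  have := pos _ es; rewrite muln_gt0 d0 /= -{2}(muln1 d) leq_pmul2l //.
  by case: e {el es} => // -[].
have din : d \in index_iota 1 y.+1.
  by rewrite mem_index_iota d0 ltnS (leq_trans _ sy) // bnd ?dl.
rewrite big_mkcond (bigD1_seq d) ?iota_uniq //= dl ds /= asboolT // big1_seq ?addn0 //.
move=> e /andP[ne _]; case: ifP => // /andP[el es].
rewrite asboolF //= => pce; move/eqP: ne; apply; apply/eqP.
have e0 := pos _ es.
by rewrite eqn_dvd; apply/andP; split; apply: (@power_coprime_quotient_max i j l s).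
Qed.

Lemma sum_count_power_coprime i j x y : 0 < j ->
  \sum_(1 <= d < y.+1) count_power_coprime i j (x %/ d ^ i) (y %/ d ^ j) = x * y.
Proof.
move=> j0.
transitivity (\sum_(1 <= d < y.+1) \sum_(1 <= l < x.+1) \sum_(1 <= s < y.+1)
   if (d ^ i %| l) && (d ^ j %| s) then
     nat_of_bool `[< power_coprime i j (l %/ d ^ i) (s %/ d ^ j) >] else 0).
  apply: eq_big_nat => d /andP[d0 _]; rewrite /count_power_coprime.
  rewrite -(@sum_dvdn_div (d ^ i) x
     (fun l => \sum_(1 <= s < (y %/ d ^ j).+1) `[< power_coprime i j l s >])) ?expn_gt0 ?d0 //.
  rewrite big_mkcond; apply: eq_bigr => l _; case: ifP => dl /=; last by rewrite big1.
  symmetry; rewrite -big_mkcond; apply: (@sum_dvdn_div (d ^ j) y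
     (fun s => nat_of_bool `[< power_coprime i j (l %/ d ^ i) s >])).
  by rewrite expn_gt0 d0.
rewrite exchange_big /=.
transitivity (\sum_(1 <= l < x.+1) \sum_(1 <= s < y.+1) 1).
  apply: eq_big_nat => l /andP[l0 _]; rewrite exchange_big /=.
  apply: eq_big_nat => s ys; rewrite -big_mkcond.
  by rewrite sum_power_coprime_quotient.
by rewrite !sum_nat_const_nat !subn1 /= muln1.
Qed.

Lemma count_power_coprime_le i j x y : count_power_coprime i j x y <= x * y.
Proof.
rewrite /count_power_coprime.
apply: (@leq_trans (\sum_(1 <= l < x.+1) \sum_(1 <= s < y.+1) 1)).
  by apply: leq_sum => l _; apply: leq_sum => s _; case: `[< _ >].
by rewrite !sum_nat_const_nat !subn1 /= muln1.
Qed.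

(** Bezout: u a = v b + 1 gives (r^u)^a = (t^v)^a r, so r is the a-th power of r^u / t^v. *)
Lemma exp_eq_exp_perfect_power a b t r : 0 < a -> 0 < b -> 0 < r ->
  gcdn a b = 1 -> t ^ a = r ^ b -> exists l, r = l ^ a.
Proof.
move=> a0 b0 r0 cop E.
have [u v uv _] := egcdnP b a0; rewrite cop in uv.
have t0 : 0 < t.
  have : 0 < t ^ a by rewrite E expn_gt0 r0.
  by rewrite expn_gt0 => /orP[//|/eqP a00]; rewrite a00 in a0.
have E2 : (r ^ u) ^ a = (t ^ v) ^ a * r.
  by rewrite -expnM uv expnD expn1 mulnC [v * b]mulnC expnM -E -!expnM [a * v]mulnC mulnC.
exists (r ^ u %/ t ^ v).
have /dvdnP[k K] : t ^ v %| r ^ u by rewrite -(@dvdn_pexp2r _ _ a) // E2 dvdn_mulr.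
rewrite K mulnK ?expn_gt0 ?t0 //; apply/eqP.
rewrite -(@eqn_pmul2l ((t ^ v) ^ a)) ?expn_gt0 ?t0 // -E2 K expnMn mulnC //.
Qed.

End Arithmetic.

(** * Partial sums and tails of zeta at integers k >= 2 *)

Section ZetaBounds.
Variables (R : realType) (k : nat).
Hypothesis k_ge2 : (2 <= k)%N.

(** Telescoping: 1/d^k <= 1/(d(d-1)) = 1/(d-1) - 1/d. *)
Lemma sum_inv_exp_tail_le n m :
  \sum_(n.+2 <= d < m) (d%:R ^+ k)^-1 <= (n.+1%:R : R)^-1.
Proof.
have [mn|nm] := leqP m n.+2; first by rewrite big_geq // invr_ge0.
have -> : m = (n.+2 + (m - n.+2))%N by rewrite subnKC // ltnW.
move: (m - n.+2)%N => p {m nm}.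
suff : \sum_(n.+2 <= d < n.+2 + p) (d%:R ^+ k)^-1
    <= (n.+1%:R : R)^-1 - ((n.+1 + p)%:R)^-1.
  by move/le_trans; apply; rewrite gerBl invr_ge0.
elim: p => [|p IH]; first by rewrite !addn0 big_geq // subrr.
rewrite addnS big_nat_recr /=; last by rewrite leq_addr.
apply: (le_trans (lerD IH
  (_ : _ <= ((n.+1 + p)%:R)^-1 - ((n.+1 + p.+1)%:R)^-1))); last by rewrite addrA subrK.
rewrite !addSn addnS; move: (n + p)%N => q.
have q0 : 0 < q.+1%:R :> R by rewrite ltr0n.
have -> : (q.+2)%:R = q.+1%:R + 1 :> R by rewrite -addn1 natrD.
move: q0; set z : R := q.+1%:R => q0.
have -> : z^-1 - (z + 1)^-1 = (z * (z + 1))^-1 by field; lra.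
rewrite lef_pV2 ?posrE ?exprn_gt0 ?mulr_gt0 //; [|lra|lra].
apply: (@le_trans _ _ ((z + 1) ^+ 2)); first by rewrite expr2; nra.
by apply: ler_weXn2l => //; lra.
Qed.

Lemma series_riemannR_nat n :
  series (riemannR (k%:R : R)) n = \sum_(1 <= d < n.+1) (d%:R ^+ k)^-1.
Proof.
rewrite /series /= big_add1 /=; apply: eq_bigr => d _.
by rewrite /riemannR powR_mulrn.
Qed.

Lemma sum_inv_exp_le_zeta n :
  \sum_(1 <= d < n.+1) (d%:R ^+ k)^-1 <= zeta (k%:R : R) /\
  zeta (k%:R : R) <= \sum_(1 <= d < n.+2) (d%:R ^+ k)^-1 + (n.+1%:R)^-1.
Proof.
have nd : {homo series (riemannR (k%:R : R)) : p q / (p <= q)%N >-> p <= q}.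
  apply/nondecreasing_series => p _ _; exact/ltW/riemannR_gt0.
have ub p : forall q, series (riemannR (k%:R : R)) q <=
    \sum_(1 <= d < p.+2) (d%:R ^+ k)^-1 + (p.+1%:R)^-1.
  move=> q; have [pq|qp] := leqP p.+1 q.
    rewrite series_riemannR_nat (@big_cat_nat _ _ _ p.+2) //= lerD2l.
    exact: sum_inv_exp_tail_le.
  apply: le_trans (nd _ _ (ltnW qp)) _; rewrite series_riemannR_nat.
  by rewrite lerDl invr_ge0.
(* [zeta] is a [limn], informative only once convergence is known. *)
have cv : cvgn (series (riemannR (k%:R : R))).
  apply: nondecreasing_is_cvgn => //.
  by eexists => _ [q _ <-]; exact: (ub 0).
split; first by rewrite -series_riemannR_nat; exact: nondecreasing_cvgn_le.
by apply: limr_le => //; near=> q; exact: ub.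
Unshelve. all: by end_near.
Qed.

Lemma inv_zeta_bounds : 0 <= (zeta (k%:R : R))^-1 <= 1.
Proof.
have [] := sum_inv_exp_le_zeta 1; rewrite big_nat1 expr1n invr1 => z1 _.
have z0 : 0 < zeta (k%:R : R) by lra.
by rewrite invr_ge0 (ltW z0) /= invf_le1.
Qed.

Lemma inv_zeta_sum_bounds n : (0 < n)%N ->
  0 <= 1 - (zeta (k%:R : R))^-1 * \sum_(1 <= d < n.+1) (d%:R ^+ k)^-1 <= n%:R^-1.
Proof.
case: n => // n _.
have [] := sum_inv_exp_le_zeta 1; rewrite big_nat1 expr1n invr1 => z1 _.
have [+ _] := sum_inv_exp_le_zeta n.+1.
have [_] := sum_inv_exp_le_zeta n.
have /andP[] := inv_zeta_bounds.
set S := \sum_(_ <= _ < _) _; set z := zeta _; set N := n.+1%:R^-1.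
move=> c0 c1 zS Sz.
have cz : z^-1 * z = 1 by rewrite mulVf //; rewrite -/z in z1; lra.
have N0 : 0 <= N by rewrite invr_ge0.
move: (z^-1) c0 c1 cz => c c0 c1 cz.
by apply/andP; split; nra.
Qed.

End ZetaBounds.

(** * Asymptotic density of power-coprime pairs *)

Section Density.
Variables (R : realType) (i j : nat).
Hypotheses (j_gt0 : (0 < j)%N) (ij_ge2 : (2 <= i + j)%N).

Local Notation V := (count_power_coprime i j).
Local Notation c := ((zeta ((i + j)%:R : R))^-1).

(* The two sides vary independently because (x / d^i, y / d^j) leaves any
   one-parameter family of boxes [x] x [y]. *)
Let eventually_close (e : R) := exists M : nat, forall x y,
  (M <= x)%N -> (M <= y)%N ->
  `|(V x y)%:R - c * (x%:R * y%:R)| <= e * (x%:R * y%:R).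

Lemma natr_divn_bounds x D : (0 < D)%N ->
  (x %/ D)%:R <= x%:R / D%:R :> R /\ x%:R / D%:R <= (x %/ D)%:R + 1 :> R.
Proof.
move=> D0; have D0' : 0 < D%:R :> R by rewrite ltr0n.
rewrite ler_pdivlMr // ler_pdivrMr // -natrM ler_nat leq_trunc_div; split=> //.
by rewrite natr1 -natrM ler_nat ltnW // -ltn_divLR.
Qed.

(** Undoing the floors changes the product X Y of the exact quotients by at most X (Y - Y') + Y' (X
    - X') <= x + y, and c <= 1. *)
Lemma close_quotient (e : R) M x y d : 0 < e ->
  (forall x y, (M <= x)%N -> (M <= y)%N ->
    `|(V x y)%:R - c * (x%:R * y%:R)| <= e * (x%:R * y%:R)) ->
  (0 < d)%N -> (M * d ^ i <= x)%N -> (M * d ^ j <= y)%N ->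
  `|(V (x %/ d ^ i) (y %/ d ^ j))%:R - c * (d%:R ^+ (i + j))^-1 * (x%:R * y%:R)|
    <= e * (x%:R * y%:R) * (d%:R ^+ (i + j))^-1 + (x%:R + y%:R).
Proof.
move=> e0 close d0 Mx My.
have d0i : (0 < d ^ i)%N by rewrite expn_gt0 d0.
have d0j : (0 < d ^ j)%N by rewrite expn_gt0 d0.
have := close (x %/ d ^ i)%N (y %/ d ^ j)%N.
rewrite !leq_divRL // => /(_ Mx My).
have [X1 X2] := natr_divn_bounds x d0i.
have [Y1 Y2] := natr_divn_bounds y d0j.
have Xx : x%:R / (d ^ i)%:R <= x%:R :> R.
  by rewrite ler_pdivrMr ?ltr0n // ler_peMr // ler1n.
have Yy : y%:R / (d ^ j)%:R <= y%:R :> R.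
  by rewrite ler_pdivrMr ?ltr0n // ler_peMr // ler1n.
have /andP[c0 c1] := inv_zeta_bounds R ij_ge2.
have -> : c * (d%:R ^+ (i + j))^-1 * (x%:R * y%:R) =
    c * ((x%:R / (d ^ i)%:R) * (y%:R / (d ^ j)%:R)).
  by rewrite exprD invfM !natrX; ring.
have -> : e * (x%:R * y%:R) * (d%:R ^+ (i + j))^-1 =
    e * ((x%:R / (d ^ i)%:R) * (y%:R / (d ^ j)%:R)).
  by rewrite exprD invfM !natrX; ring.
have : 0 <= (x %/ d ^ i)%:R :> R by [].
have : 0 <= (y %/ d ^ j)%:R :> R by [].
move: X1 X2 Y1 Y2 Xx Yy.
move: ((x %/ d ^ i)%:R : R) ((y %/ d ^ j)%:R : R) => X' Y'.
move: (x%:R / (d ^ i)%:R) (y%:R / (d ^ j)%:R) => X Y.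
move: (c) c0 c1 (V _ _)%:R => C C0 C1 v X1 X2 Y1 Y2 Xx Yy Y0 X0.
have XY1 : X' * Y' <= X * Y by apply: ler_pM.
have XY2 : X * Y <= X' * Y' + (x%:R + y%:R).
  have XY3 : X * (Y - Y') <= X by rewrite ler_piMr //; lra.
  have XY4 : Y' * (X - X') <= Y' by rewrite ler_piMr //; lra.
  by nra.
have EXY : e * (X' * Y') <= e * (X * Y) by rewrite ler_pM2l.
have CXY1 : C * (X' * Y') <= C * (X * Y) by rewrite ler_wpM2l.
have CXY2 : C * (X * Y - X' * Y') <= X * Y - X' * Y' by rewrite ler_piMl //; lra.
rewrite !ler_norml => /andP[h1 h2]; apply/andP; split; lra.
Qed.

(** The terms 2 <= d < K cost (3/4 + 1/16) e P; the terms d >= K and the truncation of zeta cost at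
    most e P / 32 each. Together this is at most 7/8 e P. *)
Lemma eventually_close_contract (e : R) : 0 < e ->
  eventually_close e -> eventually_close (7 / 8 * e).
Proof.
move=> e0 [M close].
pose B := Num.bound (32 / e).
have Be : 32 / e < B%:R by apply: archi_boundP; rewrite divr_ge0 // ltW.
have B0 : (0 < B)%N by rewrite -(ltr0n R); apply: lt_trans Be; rewrite divr_gt0.
pose K := B.+1.
(* The first summand keeps the quotients by d < K above M, the second absorbs the floor errors K (x
   + y), the third lets the sum over d <= y be split at K. *)
exists (M * K ^ (i + j) + K * B + K)%N => x y Mx My.
have Kx : (K * B <= x)%N by apply: leq_trans Mx; rewrite -addnA addnCA leq_addr.
have Ky : (K * B <= y)%N by apply: leq_trans My; rewrite -addnA addnCA leq_addr.
have Ky' : (K <= y)%N by apply: leq_trans My; rewrite leq_addl.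
have MKx : (M * K ^ (i + j) <= x)%N by apply: leq_trans Mx; rewrite -addnA leq_addr.
have MKy : (M * K ^ (i + j) <= y)%N by apply: leq_trans My; rewrite -addnA leq_addr.
pose w d : R := (d%:R ^+ (i + j))^-1.
pose v d : R := (V (x %/ d ^ i) (y %/ d ^ j))%:R.
pose P : R := x%:R * y%:R.
have P0 : 0 <= P by rewrite mulr_ge0.
have total : v 1%N + \sum_(2 <= d < K) v d + \sum_(K <= d < y.+1) v d = P.
  rewrite /P -natrM -(sum_count_power_coprime i x y j_gt0) natr_sum.
  rewrite (@big_cat_nat _ _ _ K 1 y.+1) //=; last exact: leqW.
  by rewrite (@big_ltn _ _ _ 1 K).
(* Here the trivial bound V(x', y') <= x' y' is enough. *)
have tail : 0 <= \sum_(K <= d < y.+1) v d <= P * B%:R^-1.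
  rewrite sumr_ge0 //=.
  apply: (@le_trans _ _ (P * \sum_(K <= d < y.+1) w d)).
    rewrite mulr_sumr; apply: ler_sum_nat => d /andP[Kd _].
    have d0 : (0 < d)%N by apply: leq_trans Kd.
    have d0i : (0 < d ^ i)%N by rewrite expn_gt0 d0.
    have d0j : (0 < d ^ j)%N by rewrite expn_gt0 d0.
    apply: (@le_trans _ _ ((x %/ d ^ i)%:R * (y %/ d ^ j)%:R)).
      by rewrite -natrM ler_nat count_power_coprime_le.
    have -> : P * w d = (x%:R / (d ^ i)%:R) * (y%:R / (d ^ j)%:R).
      by rewrite /w /P exprD invfM !natrX; ring.
    by apply: ler_pM => //; [case: (natr_divn_bounds x d0i)|case: (natr_divn_bounds y d0j)].
  apply: ler_wpM2l => //; rewrite /K -{2}(prednK B0) -{1}(prednK B0).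
  exact: sum_inv_exp_tail_le.
have head : `|\sum_(2 <= d < K) (v d - c * w d * P)| <=
    3 / 4 * (e * P) + K%:R * (x%:R + y%:R).
  apply: (@le_trans _ _ (\sum_(2 <= d < K) (e * P * w d + (x%:R + y%:R)))).
    apply: (le_trans (ler_norm_sum _ _ _)).
    apply: ler_sum_nat => d /andP[d2 dK].
    have d0 : (0 < d)%N by apply: leq_trans d2.
    have dKX n : (d ^ n <= K ^ n)%N by case: n => // n; rewrite leq_exp2r // ltnW.
    apply: (close_quotient e0 close) => //.
      apply: leq_trans MKx; rewrite leq_mul2l; apply/orP; right.
      apply: (@leq_trans (K ^ i)%N); first exact: dKX.
      by rewrite leq_pexp2l // leq_addr.
    apply: leq_trans MKy; rewrite leq_mul2l; apply/orP; right.
    apply: (@leq_trans (K ^ j)%N); first exact: dKX.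
    by rewrite leq_pexp2l // leq_addl.
  rewrite big_split /= -mulr_sumr; apply: lerD.
    rewrite mulrC ler_wpM2r //; first by rewrite mulr_ge0 // ltW.
    (* The contraction factor 3/4 is 1/4 from d = 2 plus 1/2 from d >= 3. *)
    have w3 : \sum_(3 <= d < K) w d <= 2^-1 by exact: (@sum_inv_exp_tail_le _ _ _ 1).
    have w2 : w 2%N <= 4^-1.
      rewrite /w lef_pV2 ?posrE ?exprn_gt0 ?ltr0n //.
      apply: (@le_trans _ _ (2%:R ^+ 2)); first by rewrite -natrX.
      by apply: ler_weXn2l => //; rewrite ler1n.
    have [K2|K2] := leqP K 2; first by rewrite big_geq //; lra.
    by rewrite (@big_ltn _ _ _ 2 K) //; lra.
  rewrite sumr_const_nat -[X in X <= _]mulr_natl ler_wpM2r ?addr_ge0 //.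
  by rewrite ler_nat leq_subr.
have := inv_zeta_sum_bounds R ij_ge2 B0.
rewrite -/K (@big_ltn _ _ _ 1 K) // expr1n invr1.
rewrite sumrB -mulr_suml -mulr_sumr in head.
have -> : (V x y)%:R = v 1%N by rewrite /v !exp1n !divn1.
rewrite -/P.
have xy_small : K%:R * (x%:R + y%:R) <= e / 16 * P.
  have scale (z : nat) : (K * B <= z)%N -> K%:R <= e / 32 * z%:R.
    rewrite -(ler_nat R) natrM => Kz.
    have eB : 32 < e * B%:R by rewrite mulrC -ltr_pdivrMr.
    have K0 : 0 <= K%:R :> R by [].
    have : e * (K%:R * B%:R) <= e * z%:R by rewrite ler_pM2l.
    by move=> h; nra.
  have h1 : K%:R * x%:R <= e / 32 * P.
    rewrite /P (mulrC x%:R) mulrA ler_wpM2r //; exact: scale.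
  have h2 : K%:R * y%:R <= e / 32 * P.
    rewrite /P mulrA ler_wpM2r //; exact: scale.
  by rewrite mulrDr; lra.
have PB : P * B%:R^-1 <= e / 32 * P.
  rewrite mulrC ler_wpM2r // -[X in _ <= X]invrK lef_pV2 ?posrE ?invr_gt0 ?ltr0n //.
    by rewrite invf_div ltW.
  by rewrite divr_gt0.
move: head total tail PB => + + + PB.
move: (\sum_(2 <= d < K) w d) => W; rewrite -/(w _).
move: (\sum_(2 <= d < K) v d) (\sum_(K <= d < y.+1) v d) => v2 v3.
move: (v 1%N) (K%:R * _) xy_small => v1 T xy_small.
have /andP[] := inv_zeta_bounds R ij_ge2.
move: (c) => C C0 C1.
rewrite !ler_norml => /andP[h1 h2] t /andP[v30 v31] /andP[s1 s2].
(* By [t], V x y - c P is P (1 - c (1 + W)) minus the sums bounded in [head] and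
   [tail]. *)
have s3 : 0 <= P * (1 - C * (1 + W)) by rewrite mulr_ge0.
have s4 : P * (1 - C * (1 + W)) <= P * B%:R^-1 by rewrite ler_wpM2l.
have E : C * W * P = C * P * W by ring.
have E2 : P * (1 - C * (1 + W)) = P - C * P - C * P * W by ring.
have eP : 0 <= e * P by rewrite mulr_ge0 // ltW.
rewrite E2 in s3 s4; rewrite E in h1 h2.
by apply/andP; split; lra.
Qed.

Lemma count_power_coprime_asymptotic (e : R) : 0 < e -> eventually_close e.
Proof.
move=> e0.
(* The iteration starts at 1: V and c x y both lie between 0 and x y. *)
have close1 : eventually_close 1.
  exists 0%N => x y _ _.
  have /andP[c0 c1] := inv_zeta_bounds R ij_ge2.
  have : (V x y)%:R <= x%:R * y%:R :> R by rewrite -natrM ler_nat count_power_coprime_le.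
  have : 0 <= (V x y)%:R :> R by [].
  have : 0 <= x%:R * y%:R :> R by [].
  rewrite ler_norml; move: (x%:R * y%:R) (V x y)%:R (c) c0 c1 => P v C C0 C1 P0 v0 vP.
  by apply/andP; split; nra.
have closeX n : eventually_close ((7 / 8) ^+ n).
  elim: n => [|n IH]; first by rewrite expr0.
  by rewrite exprS; apply: eventually_close_contract => //; rewrite exprn_gt0 //; lra.
have [n ne] : exists n, (7 / 8 : R) ^+ n <= e.
  have lt1 : `|7 / 8 : R| < 1 by rewrite ger0_norm; lra.
  have /cvgrPdist_le/(_ _ e0)[n _ /(_ n (leqnn n))] := cvg_expr lt1.
  by rewrite /= sub0r normrN ger0_norm ?exprn_ge0 //; exists n.
have [M close] := closeX n; exists M => x y Mx My.
by apply: (le_trans (close x y Mx My)); rewrite ler_wpM2r // mulr_ge0.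
Qed.

End Density.

(** * Visibility as a divisibility condition *)

Section Visibility.
Variables (R : realType) (a b : nat).
Hypotheses (a_gt0 : (0 < a)%N) (b_gt0 : (0 < b)%N) (coprime_ab : gcdn a b = 1%N).

Local Notation c := (b%:R / a%:R : rat).

(** The hypothesis is the graph equation raised to the power a. It gives s | t, and q = t / s
    satisfies q^a = r^b. *)
Lemma exp_eq_mul_exp s r t : (0 < s)%N -> (0 < r)%N -> (t ^ a = s ^ a * r ^ b)%N ->
  exists l, r = (l ^ a)%N /\ t = (s * l ^ b)%N.
Proof.
move=> s0 r0 E.
have /dvdnP[q tq] : (s %| t)%N by rewrite -(@dvdn_pexp2r _ _ a) // E dvdn_mulr.
have qr : (q ^ a = r ^ b)%N.
  apply/eqP; rewrite -(@eqn_pmul2l (s ^ a)) ?expn_gt0 ?s0 //.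
  by rewrite -E tq expnMn mulnC.
have [l rl] := exp_eq_exp_perfect_power a_gt0 b_gt0 r0 coprime_ab qr.
exists l; split=> //; rewrite tq mulnC; congr (_ * _)%N.
by apply/eqP; rewrite -(@eqn_exp2r _ _ a) // qr rl -!expnM mulnC.
Qed.

(** d is the numerator of u / v in lowest terms. A second point on the curve thus yields a divisor;
    u is the larger of the two a-th roots of abscissas. *)
Lemma exp_ratio_dvdn s t u v : (0 < u)%N -> (t * u ^ b = s * v ^ b)%N ->
  exists d, [/\ (d %| u)%N, (d ^ b %| s)%N & d = 1%N -> (u %| v)%N].
Proof.
move=> u0 E; pose g := gcdn u v.
have g0 : (0 < g)%N by rewrite gcdn_gt0 u0.
have [/dvdnP[d ud] /dvdnP[m vm]] : (g %| u)%N /\ (g %| v)%N.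
  by rewrite dvdn_gcdl dvdn_gcdr.
have cop : coprime d m.
  by rewrite /coprime -(eqn_pmul2r g0) mul1n muln_gcdl -ud -vm.
exists d; split; first by rewrite ud dvdn_mulr.
  have : (d ^ b %| s * m ^ b)%N.
    suff -> : (s * m ^ b = t * d ^ b)%N by rewrite dvdn_mull.
    apply/eqP; rewrite -(@eqn_pmul2r (g ^ b)) ?expn_gt0 ?g0 //.
    by rewrite -!mulnA -!expnMn -ud -vm E.
  by rewrite Gauss_dvdl // coprimeXl // coprimeXr.
by move=> d1; rewrite ud d1 mul1n dvdn_gcdr.
Qed.

Lemma ratr_exponent : ratr c = b%:R / a%:R :> R.
Proof. by rewrite fmorph_div /= !ratr_nat. Qed.

Lemma powR_exponent_exp (x : R) : 0 <= x -> (x `^ ratr c) ^+ a = x ^+ b.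
Proof.
move=> x0; rewrite -powR_mulrn ?powR_ge0 // -powRrM ratr_exponent divfK.
  by rewrite powR_mulrn.
by rewrite pnatr_eq0 -lt0n.
Qed.

Lemma powR_exponent_natX l : (l ^ a)%:R `^ ratr c = l%:R ^+ b :> R.
Proof.
rewrite natrX -powR_mulrn // -powRrM ratr_exponent mulrC divfK ?powR_mulrn //.
by rewrite pnatr_eq0 -lt0n.
Qed.

Lemma power_coprime_divisor_gt1 s d : (0 < s)%N -> (d ^ b %| s)%N ->
  d != 1%N -> (1 < d)%N.
Proof.
case: d => [|[|d]] //; rewrite exp0n // dvd0n => s0 /eqP s00.
by rewrite s00 in s0.
Qed.

Lemma visible_power_coprime l s : (0 < l)%N -> (0 < s)%N ->
  visible R c (l ^ a, s)%N <-> power_coprime 1 b l s.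
Proof.
move=> l0 s0; have lb0 : (l ^ b)%:R != 0 :> R by rewrite pnatr_eq0 -lt0n expn_gt0 l0.
split=> [[_ [n [sn noq]]] d|pc].
  rewrite expn1 => /dvdnP[m lm] /[dup] ds /dvdnP[t st].
  apply/eqP/negP => /negP d1; apply: noq.
  have d2 := power_coprime_divisor_gt1 s0 ds d1.
  have m0 : (0 < m)%N by case: m lm l0 => // ->.
  have t0 : (0 < t)%N by case: t st s0 => // ->.
  have db0 : (d ^ b)%:R != 0 :> R by rewrite pnatr_eq0 -lt0n expn_gt0 ltnW.
  (* The blocking point is ((l/d)^a, s/d^b). *)
  exists (m ^ a, t)%N; split=> /=.
  - by split=> //=; rewrite expn_gt0 m0.
  - move: sn; rewrite /on_graph /= !powR_exponent_natX st lm -!natrX expnMn !natrM.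
    by rewrite mulrA => /(mulIf db0).
  - by rewrite ltn_exp2r // lm ltn_Pmulr.
split; first by split=> //=; rewrite expn_gt0 l0.
pose n : rat := s%:R / (l ^ b)%:R.
have En : ratr n = s%:R / (l ^ b)%:R :> R by rewrite fmorph_div /= !ratr_nat.
exists n; split; first by rewrite /on_graph /= powR_exponent_natX En -natrX divfK.
case=> -[r t] [[/= r0 t0]]; rewrite /on_graph /= => tn rl.
have /exp_eq_mul_exp[//|//|k [rk tk]] : ((t * l ^ b) ^ a = s ^ a * r ^ b)%N.
  apply/eqP; rewrite -(eqr_nat R) natrX natrM tn En mulrAC divfK //.
  by rewrite exprMn powR_exponent_exp // natrM !natrX.
have [d [dl ds d1]] := exp_ratio_dvdn l0 tk.
have := d1 (pc d _ ds); rewrite expn1 => /(_ dl) lk.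
move: rl; rewrite rk ltn_exp2r // ltnNge dvdn_leq //.
by move: r0; rewrite rk expn_gt0 eqn0Ngt a_gt0 orbF.
Qed.

Lemma visible_infty_power_coprime l s : (0 < l)%N -> (0 < s)%N ->
  visible_infty R c (l ^ a, s)%N <-> power_coprime 0 b l s.
Proof.
move=> l0 s0; have lb0 : (l ^ b)%:R != 0 :> R by rewrite pnatr_eq0 -lt0n expn_gt0 l0.
split=> [[_ [n [sn noq]]] d|pc].
  move=> _ /[dup] ds /dvdnP[t st].
  apply/eqP/negP => /negP d1; apply: noq.
  have d2 := power_coprime_divisor_gt1 s0 ds d1.
  have t0 : (0 < t)%N by case: t st s0 => // ->.
  have db0 : (d ^ b)%:R != 0 :> R by rewrite pnatr_eq0 -lt0n expn_gt0 ltnW.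
  (* Towards infinity the root of the abscissa is multiplied by d, so nothing is asked of l; hence
     the index [i = 0]. *)
  exists ((l * d) ^ a, t)%N; split=> /=.
  - by split=> //=; rewrite expn_gt0 muln_gt0 l0 ltnW.
  - move: sn; rewrite /on_graph /= rmorphN /= !powRN !powR_exponent_natX st -!natrX.
    rewrite expnMn !natrM invfM mulrA => <-.
    by rewrite mulfK.
  - by rewrite ltn_exp2r // ltn_Pmulr.
split; first by split=> //=; rewrite expn_gt0 l0.
pose n : rat := s%:R * (l ^ b)%:R.
have En : ratr n = s%:R * (l ^ b)%:R :> R by rewrite rmorphM /= !ratr_nat.
exists n; split.
  by rewrite /on_graph /= rmorphN /= powRN powR_exponent_natX En -natrX mulfK.
case=> -[r t] [[/= r0 t0]]; rewrite /on_graph /= rmorphN /= powRN => tn rl.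
have rb0 : r%:R `^ ratr c != 0 :> R by rewrite gt_eqF // powR_gt0 // ltr0n.
have /exp_eq_mul_exp[//|//|k [rk tk]] : ((s * l ^ b) ^ a = t ^ a * r ^ b)%N.
  apply/eqP; rewrite -(eqr_nat R) natrX natrM -En natrM !natrX -powR_exponent_exp //.
  by rewrite -exprMn tn divfK.
have k0 : (0 < k)%N.
  by move: r0; rewrite rk expn_gt0 eqn0Ngt a_gt0 orbF.
have [d [_ ds d1]] := exp_ratio_dvdn k0 (esym tk).
have kl := d1 (pc d (dvd1n _) ds).
by move: rl; rewrite rk ltn_exp2r // ltnNge dvdn_leq.
Qed.

End Visibility.

(** * From box counts to proportions *)

Section Proportion.
Variables (R : realType) (a : nat).
Hypothesis a_gt0 : (0 < a)%N.

Lemma leq_expn_self m : (m <= m ^ a)%N.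
Proof. by case: m => // m; rewrite -{1}(expn1 m.+1) leq_pexp2l. Qed.

(** L is floor(N^(1/a)); the second conjunct makes it tend to infinity with N. *)
Lemma powers_uptoE N : exists L, powers_upto a N = [seq (l ^ a)%N | l <- iota 1 L] /\
  forall m, (m ^ a <= N)%N -> (m <= L)%N.
Proof.
have exL : exists l, (l ^ a <= N)%N by exists 0%N; rewrite exp0n.
have bnd l : (l ^ a <= N)%N -> (l <= N)%N by exact: leq_trans (leq_expn_self l).
have [L LN Lmax] := ex_maxnP exL bnd; exists L; split=> //.
rewrite /powers_upto; congr map; apply: (irr_sorted_eq ltn_trans ltnn).
- by apply: sorted_filter; [exact: ltn_trans|exact: iota_ltn_sorted].
- exact: iota_ltn_sorted.
move=> l; rewrite mem_filter !mem_iota !add1n !ltnS.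
apply/idP/idP => [/and3P[/Lmax lL l0 _]|/andP[l0 lL]]; first by rewrite l0.
have lN : (l ^ a <= N)%N by apply: leq_trans LN; rewrite leq_exp2r.
by rewrite lN l0 bnd.
Qed.

Lemma fractionE (P : nat * nat -> Prop) i b N :
  (forall l s, (0 < l)%N -> (0 < s)%N -> P (l ^ a, s)%N <-> power_coprime i b l s) ->
  exists L, fraction R a P N = (count_power_coprime i b L N)%:R / (L%:R * N%:R) /\
  forall m, (m ^ a <= N)%N -> (m <= L)%N.
Proof.
move=> Ppc; have [L [E Lmax]] := powers_uptoE N.
exists L; split=> //; rewrite /fraction /box E size_allpairs size_map !size_iota natrM.
congr (_%:R / _); rewrite -sum1_count big_mkcond big_allpairs big_map.
rewrite /count_power_coprime /index_iota !subn1 /=.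
apply: eq_big_seq => l; rewrite mem_iota => /andP[l0 _].
apply: eq_big_seq => s; rewrite mem_iota => /andP[s0 _].
by rewrite (asbool_equiv_eq (Ppc l s l0 s0)); case: `[< _ >].
Qed.

Lemma has_proportion_power_coprime (P : nat * nat -> Prop) i b :
  (0 < b)%N -> (2 <= i + b)%N ->
  (forall l s, (0 < l)%N -> (0 < s)%N -> P (l ^ a, s)%N <-> power_coprime i b l s) ->
  has_proportion a P (zeta ((i + b)%:R : R))^-1.
Proof.
move=> b0 ib Ppc; apply/cvgrPdist_le => e e0.
have [M close] := count_power_coprime_asymptotic b0 ib e0.
(* This threshold puts both L and N above M and makes L N positive. *)
exists (M.+1 ^ a)%N => // N /= MN.
have [L [-> /(_ _ MN) ML]] := fractionE N Ppc.
have {}MN : (M.+1 <= N)%N by apply: leq_trans MN; exact: leq_expn_self.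
have LN0 : 0 < L%:R * N%:R :> R by rewrite -natrM ltr0n muln_gt0 (leq_trans _ ML) ?(leq_trans _ MN).
have h := close L N (ltnW ML) (ltnW MN).
rewrite -[X in `|X - _|](mulfK (lt0r_neq0 LN0)) -mulrBl normrM normfV (gtr0_norm LN0).
by rewrite ler_pdivrMr // distrC.
Qed.

(** Taking d = s shows that only s = 1 survives, so the fraction is at most L / (L N) = 1 / N. *)
Lemma has_proportion_power_coprime01 (P : nat * nat -> Prop) :
  (forall l s, (0 < l)%N -> (0 < s)%N -> P (l ^ a, s)%N <-> power_coprime 0 1 l s) ->
  has_proportion a P (0 : R).
Proof.
move=> Ppc; apply/cvgrPdist_le => e e0.
exists (Num.bound e^-1).+1 => // N /= eN.
have [L [-> Lmax]] := fractionE N Ppc.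
have N0 : (0 < N)%N by apply: leq_trans eN.
have L0 : (0 < L)%N by apply: Lmax; rewrite exp1n.
have VL : (count_power_coprime 0 1 L N <= L)%N.
  rewrite /count_power_coprime -[X in (_ <= X)%N]muln1 -[X in (_ <= X * _)%N]subn0.
  rewrite -subSS -sum_nat_const_nat; apply: leq_sum => l _.
  rewrite big_ltn // big1_seq ?addn0 ?leq_b1 // => s; rewrite mem_index_iota => /and3P[_ s1 _].
  by rewrite asboolF // => /(_ s (dvd1n _)); rewrite expn1 dvdnn => /(_ isT) s1'; rewrite s1' in s1.
rewrite sub0r normrN ger0_norm ?divr_ge0 ?mulr_ge0 //.
rewrite ler_pdivrMr ?mulr_gt0 ?ltr0n //.
apply: (@le_trans _ _ L%:R); first by rewrite ler_nat.
rewrite mulrCA ler_peMr // mulrC -ler_pdivrMr // div1r.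
apply: ltW; apply: lt_le_trans (archi_boundP _) _; first by rewrite invr_ge0 ltW.
by rewrite ler_nat ltnW.
Qed.

End Proportion.

Theorem mainTheorem1 (R : realType) (a b : nat)
    (a_gt0 : (0 < a)%N) (b_gt0 : (0 < b)%N) (coprime_ab : gcdn a b = 1%N) :
  has_proportion a (visible R (b%:R / a%:R)) ((zeta (b.+1%:R : R))^-1) /\
  has_proportion a (visible_infty R (b%:R / a%:R)) (inv_zeta (b%:R : R)).
Proof.
split.
  apply: (@has_proportion_power_coprime R a a_gt0 _ 1 b) => // l s l0 s0.
  exact: visible_power_coprime.
have Ppc := visible_infty_power_coprime R a_gt0 b_gt0 coprime_ab.
rewrite /inv_zeta pnatr_eq1; case: eqP => [b1|/eqP b1].
  by rewrite b1 in Ppc *; exact: has_proportion_power_coprime01.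
by apply: (@has_proportion_power_coprime R a a_gt0 _ 0 b) => //; rewrite add0n ltn_neqAle eq_sym b1.
Qed.
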